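(* Let $F = F(x,y)$ be the free group on $x$ and $y$. Let $r \in F$ and let $(A,B)$ be the exponent sum pair of $r$. For $p \in F$, let $\langle\langle p \rangle\rangle$ denote the normal closure of $p$ in $F$. If $(A,B) = (0,0)$, then $r \in \langle\langle p \rangle\rangle$ for each primitive element $p$ in $F$. If $(A,B) \ne (0,0)$, then, for a primitive element $p$ in $F$, $r \in \langle\langle p \rangle\rangle$ if and only if the exponent sum pair of $p$ is $\frac{1}{d}(A,B)$ or $-\frac{1}{d}(A,B)$, where $d$ is the greatest common divisor of $A$ and $B$.
   Context: An element of $F$ is primitive if it is the image of $x$ under some automorphism of $F$. The exponent sum pair of $w \in F$ is the pair of integers $(X,Y)$, where $X$ is the exponent sum of $x$ in $w$ and $Y$ is the exponent sum of $y$ in $w$. *)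

(* Defs.v *)
From HB Require Import structures.
From mathcomp Require Import all_boot all_order all_algebra.

Set Implicit Arguments.
Unset Strict Implicit.
Unset Printing Implicit Defensive.

Import GRing.Theory.

(* In a word, (t, false) stands for the generator t and (t, true)
   for its inverse. *)
Definition inv_letter (T : Type) (a : T * bool) : T * bool := (a.1, ~~ a.2).

Definition reduced (T : choiceType) (w : seq (T * bool)) : bool :=
  sorted (fun a b => b != inv_letter a) w.

Record free_group (T : choiceType) : Type := FreeGroup {
  word :> seq (T * bool);
  _ : reduced word }.

HB.instance Definition _ (T : choiceType) := [isSub for @word T].
HB.instance Definition _ (T : choiceType) := [Choice of free_group T by <:].

Section FreeGroupTheory.
Variable T : choiceType.
Implicit Types (a b : T * bool) (u v w : seq (T * bool)) (g h k : free_group T).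

Lemma inv_letterK : involutive (@inv_letter T).
Proof. by case=> t e; rewrite /inv_letter /= negbK. Qed.

Definition push a w : seq (T * bool) :=
  if w is b :: w' then if b == inv_letter a then w' else a :: w else [:: a].

Definition reduce w : seq (T * bool) := foldr push [::] w.

Lemma push_reduced a w : reduced w -> reduced (push a w).
Proof.
case: w => [|b w] //= bw; case: ifP => [_|/negbT ab]; first exact: path_sorted bw.
by rewrite /reduced /= ab.
Qed.

Lemma foldr_push_reduced u v : reduced v -> reduced (foldr push v u).
Proof. by move=> rv; elim: u => //= a u; apply: push_reduced. Qed.

Lemma reduce_reduced w : reduced (reduce w).
Proof. exact: foldr_push_reduced. Qed.

Lemma push_id a w : reduced (a :: w) -> push a w = a :: w.
Proof. by case: w => //= b w /andP[/negPf-> _]. Qed.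

Lemma reduce_id w : reduced w -> reduce w = w.
Proof.
elim: w => //= a w IH aw; rewrite /reduce /= -/(reduce w) IH ?push_id //.
exact: path_sorted aw.
Qed.

Lemma pushK a w : reduced w -> push a (push (inv_letter a) w) = w.
Proof.
case: w => [|b w] rw /=; first by rewrite eqxx.
rewrite inv_letterK; case: eqP => [ba|_] /=; last by rewrite eqxx.
by rewrite ba in rw *; rewrite push_id.
Qed.

Lemma foldr_push_push a w v : reduced v ->
  foldr push v (push a w) = push a (foldr push v w).
Proof.
move=> rv; case: w => //= b w; case: eqP => //= ->.
by rewrite pushK // foldr_push_reduced.
Qed.

Lemma foldr_push_reduce u v : reduced v ->
  foldr push v (reduce u) = foldr push v u.
Proof.
move=> rv; elim: u => //= a u IH.
by rewrite /reduce /= -/(reduce u) foldr_push_push // IH.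
Qed.

Lemma reduce_catl u v : reduce (reduce u ++ v) = reduce (u ++ v).
Proof. by rewrite /reduce !foldr_cat foldr_push_reduce ?reduce_reduced. Qed.

Lemma reduce_catr u v : reduce (u ++ reduce v) = reduce (u ++ v).
Proof.
by rewrite /reduce !foldr_cat -!/(reduce _) (reduce_id (reduce_reduced v)).
Qed.

Definition inv_word w : seq (T * bool) := rev (map (@inv_letter T) w).

Lemma inv_wordK : involutive inv_word.
Proof.
by move=> w; rewrite /inv_word map_rev revK -map_comp map_id_in // => a _; apply: inv_letterK.
Qed.

Lemma inv_word_reduced w : reduced w -> reduced (inv_word w).
Proof.
rewrite /inv_word /reduced rev_sorted sorted_map; apply: sub_sorted => a b /=.
by rewrite inv_letterK; apply: contraNneq => ->.
Qed.

Lemma reduce_word_inv w : reduce (w ++ inv_word w) = [::].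
Proof.
elim: w => //= a w IH.
rewrite /inv_word /= rev_cons -cats1 catA -/(inv_word w).
rewrite /reduce /= -/(reduce _) -reduce_catl IH /=.
by rewrite /reduce /= eqxx.
Qed.

Definition free_one : free_group T := @FreeGroup T [::] isT.
Definition free_mul g h : free_group T := FreeGroup (reduce_reduced (g ++ h)).
Definition free_inv g : free_group T := FreeGroup (inv_word_reduced (valP g)).

Lemma free_mulA : associative free_mul.
Proof. by move=> g h k; apply: val_inj; rewrite /= reduce_catr reduce_catl catA. Qed.

Lemma free_mul1 : left_id free_one free_mul.
Proof. by move=> g; apply: val_inj; rewrite /= reduce_id ?(valP g). Qed.

Lemma free_mulr1 : right_id free_one free_mul.
Proof. by move=> g; apply: val_inj; rewrite /= cats0 reduce_id ?(valP g). Qed.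

Lemma free_mulV : right_inverse free_one free_inv free_mul.
Proof. by move=> g; apply: val_inj; rewrite /= reduce_word_inv. Qed.

Lemma free_mulVl : left_inverse free_one free_inv free_mul.
Proof.
by move=> g; apply: val_inj; rewrite /= -{2}(inv_wordK g) reduce_word_inv.
Qed.

HB.instance Definition _ := isGroup.Build (free_group T)
  free_mulA free_mul1 free_mulr1 free_mulVl free_mulV.

Definition gen (t : T) : free_group T := @FreeGroup T [:: (t, false)] isT.

Definition exponent_sum (t : T) g : int :=
  ((count_mem (t, false) (word g))%:Z - (count_mem (t, true) (word g))%:Z)%R.

End FreeGroupTheory.

Definition normal_subgroup (G : groupType) (N : G -> Prop) : Prop :=
  [/\ N 1%g,
      forall g h, N g -> N h -> N (g * h)%g,
      forall g, N g -> N (g^-1)%g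
    & forall g h, N g -> N (g ^ h)%g].

Definition in_normal_closure (G : groupType) (p r : G) : Prop :=
  forall N : G -> Prop, normal_subgroup N -> N p -> N r.

Definition F : groupType := free_group bool.
Definition x : F := gen false.
Definition y : F := gen true.

Definition primitive (p : F) : Prop :=
  exists phi : {multiplicative F -> F}, bijective phi /\ p = phi x.

Definition exponent_sum_pair (w : F) : int * int :=
  (exponent_sum false w, exponent_sum true w).

(* Main.v *)
(** Let [p = phi x] with [phi] an automorphism.  Modulo the normal closure of
    [x] every [u] is a power of [y], so [u] lies in it iff its [y]-exponent sum
    vanishes; transporting along [phi], [r = phi u] lies in the normal closure
    of [p] iff the [y]-exponent sum of [u] vanishes.  As [phi] acts on exponent
    sum pairs by an integer matrix of determinant 1 or -1 whose first row is
    the pair [(X, Y)] of [p], this says that [X] and [Y] are coprime and that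
    [(A, B)] is proportional to [(X, Y)]. *)

Require Import Defs.
From HB Require Import structures.
From mathcomp Require Import all_boot all_order all_algebra.
From mathcomp Require Import ring.

Import Order.TTheory GRing.Theory Num.Theory.

Section FreeGroup.
Variable T : choiceType.
Implicit Types (t s : T) (a : T * bool) (w : seq (T * bool)) (g h : free_group T).

(** Induction on the reduced word: its tail is again reduced, and pushing the first letter back
    cancels nothing, so it is left multiplication by a generator or its inverse. *)
Lemma free_group_ind (P : free_group T -> Prop) :
    P 1%g ->
    (forall t g, P g -> P (gen t * g)%g) ->
    (forall t g, P g -> P ((gen t)^-1 * g)%g) ->
  forall g, P g.
Proof.
move=> P1 Pg PV [w]; elim: w => [|[t e] w IH] rw.
  by have -> : FreeGroup rw = 1%g by apply: val_inj.
have rw' : reduced w by apply: path_sorted rw.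
have wE : push (t, e) (reduce w) = (t, e) :: w by rewrite reduce_id // push_id.
case: e rw wE => rw wE.
  suff -> : FreeGroup rw = ((gen t)^-1 * FreeGroup rw')%g by exact: PV.
  by apply: val_inj; rewrite /= -wE.
suff -> : FreeGroup rw = (gen t * FreeGroup rw')%g by exact: Pg.
by apply: val_inj; rewrite /= -wE.
Qed.

(** Needed on unreduced words, since a product in the free group first concatenates and then
    reduces. *)
Definition word_exponent_sum t w : int :=
  ((count_mem (t, false) w)%:Z - (count_mem (t, true) w)%:Z)%R.

Lemma word_exponent_sum_push t a w :
  word_exponent_sum t (push a w) = word_exponent_sum t (a :: w).
Proof.
case: w => [//|b w] /=; case: eqP => [->|//].
rewrite /word_exponent_sum /= /inv_letter; case: a => s e /=.
by rewrite !xpair_eqE !PoszD; case: eqP => _; case: e => /=; ring.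
Qed.

Lemma word_exponent_sum_cat t w1 w2 :
  word_exponent_sum t (w1 ++ w2) =
  (word_exponent_sum t w1 + word_exponent_sum t w2)%R.
Proof. by rewrite /word_exponent_sum !count_cat !PoszD; ring. Qed.

Lemma word_exponent_sum_reduce t w :
  word_exponent_sum t (reduce w) = word_exponent_sum t w.
Proof.
elim: w => //= a w IH; rewrite word_exponent_sum_push.
by rewrite -[a :: reduce w]cat1s -[a :: w]cat1s !word_exponent_sum_cat IH.
Qed.

Lemma exponent_sumM t g h :
  exponent_sum t (g * h)%g = (exponent_sum t g + exponent_sum t h)%R.
Proof.
by rewrite -[LHS]/(word_exponent_sum t (reduce (g ++ h)))
  word_exponent_sum_reduce word_exponent_sum_cat.
Qed.

Lemma exponent_sum1 t : exponent_sum t 1%g = 0%R.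
Proof. by []. Qed.

Lemma exponent_sumV t g : exponent_sum t g^-1%g = (- exponent_sum t g)%R.
Proof. by apply/eqP; rewrite -addr_eq0 -exponent_sumM mulVg. Qed.

Lemma exponent_sum_gen t s : exponent_sum t (gen s) = ((s == t)%:Z)%R.
Proof. by rewrite /exponent_sum /= !xpair_eqE /= andbT andbF subr0 addn0. Qed.

End FreeGroup.

Lemma multiplicative1 (G H : groupType) (phi : {multiplicative G -> H}) :
  phi 1%g = 1%g.
Proof. by apply: (mulgI (phi 1%g)); rewrite -gmulfM !mulg1. Qed.

(** Gives the maps in [primitive] the structure that [gmulf1] and [gmulfV] require. *)
Definition group_morphism (G H : groupType) (phi : {multiplicative G -> H}) :
    UMagmaMorphism.type G H :=
  HB.pack (Multiplicative.sort phi) (Multiplicative.class phi)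
    (Multiplicative_isUMagmaMorphism.Build G H phi (multiplicative1 G H phi)).

(** This is the action of [phi] on the abelianization, by the matrix whose rows are the pairs of
    [phi x] and [phi y]. *)
Lemma exponent_sum_morph (phi : UMagmaMorphism.type F F) t (u : F) :
  exponent_sum t (phi u) =
  (exponent_sum false u * exponent_sum t (phi x) +
   exponent_sum true u * exponent_sum t (phi y))%R.
Proof.
elim/(@free_group_ind bool): u => [|s u IH|s u IH].
- by rewrite gmulf1 !exponent_sum1 !mul0r.
- rewrite gmulfM !exponent_sumM IH !exponent_sum_gen.
  by case: s => /=; rewrite -/x -/y; ring.
rewrite gmulfM gmulfV !exponent_sumM !exponent_sumV IH !exponent_sum_gen.
by case: s => /=; rewrite -/x -/y; ring.
Qed.

Lemma in_normal_closure_x (u : F) :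
  in_normal_closure x u <-> exponent_sum true u = 0%R.
Proof.
split=> [xu|u0 N [N1 NM NV NJ] Nx].
  apply: (xu (fun g => exponent_sum true g = 0%R)); last by rewrite exponent_sum_gen.
  split=> [//|g h|g|g h]; rewrite ?exponent_sumM ?exponent_sumV.
  - by move=> -> ->.
  - by move=> ->.
  - by move=> ->; ring.
(* [u] is congruent to [y ^ (m - n)] modulo [N]; two natural exponents avoid
   integer powers. *)
have [m [n [umn Nu]]] : exists m n : nat,
    exponent_sum true u = (m%:Z - n%:Z)%R /\ N (u * y ^+ n * y ^- m)%g.
  elim/(@free_group_ind bool): u {u0} => [|s u [m [n [umn Nu]]]|s u [m [n [umn Nu]]]].
  - by exists 0, 0; rewrite !mul1g invg1.
  - case: s; last first.
      exists m, n; rewrite exponent_sumM exponent_sum_gen umn add0r; split=> //.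
      by rewrite -!mulgA; apply: NM => //; rewrite mulgA.
    exists m.+1, n; rewrite exponent_sumM exponent_sum_gen umn /= -/y.
    split; first by rewrite -addn1 PoszD; ring.
    (* Conjugating by [y^-1] puts [y] in front of [u] and one more [y^-1] at the end. *)
    move/NJ: Nu => /(_ y^-1%g).
    by rewrite conjgE invgK expgS invgM !mulgA.
  case: s; last first.
    exists m, n; rewrite exponent_sumM exponent_sumV exponent_sum_gen umn /=.
    rewrite oppr0 add0r; split=> //.
    by rewrite -!mulgA; apply: NM; [exact: NV | rewrite mulgA].
  exists m, n.+1; rewrite exponent_sumM exponent_sumV exponent_sum_gen umn /= -/y.
  split; first by rewrite -addn1 PoszD; ring.
  move/NJ: Nu => /(_ y)%g.
  have yC : commute y (y ^- m) by apply/commuteV/commuteX.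
  by rewrite conjgE expgSr -!mulgA yC.
have mn : m = n by move: umn; rewrite u0 => /esym/eqP; rewrite subr_eq0 => /eqP[].
by move: Nu; rewrite mn mulgK.
Qed.

(** The preimage of a normal subgroup under [phi] is normal. *)
Lemma in_normal_closure_morph (G H : groupType) (phi : UMagmaMorphism.type G H)
    (p r : G) :
  in_normal_closure p r -> in_normal_closure (phi p) (phi r).
Proof.
move=> pr N [N1 NM NV NJ] Np; apply: (pr (fun g => N (phi g))) => //.
split=> [|g h|g|g h]; first by rewrite gmulf1.
- by rewrite gmulfM; apply: NM.
- by rewrite gmulfV; apply: NV.
- by rewrite gmulfJ; apply: NJ.
Qed.

Lemma in_normal_closure_iso (G H : groupType) (phi : UMagmaMorphism.type G H)
    (p r : G) :
  bijective phi ->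
  in_normal_closure (phi p) (phi r) <-> in_normal_closure p r.
Proof.
move=> [psi phiK psiK]; split; last exact: in_normal_closure_morph.
have psiM := isMultiplicative.Build H G psi (can2_gmulfM phiK psiK).
pose psi' : {multiplicative H -> G} := HB.pack psi psiM.
by move/(in_normal_closure_morph _ _ (group_morphism _ _ psi')); rewrite /= !phiK.
Qed.

Lemma primitive_bezout_normal_closure (p : F)
    (X := exponent_sum false p) (Y := exponent_sum true p) :
  primitive p ->
  (exists u v : int, u * X + v * Y = 1)%R /\
  forall r : F, in_normal_closure p r <->
    (exponent_sum false r * Y = exponent_sum true r * X)%R.
Proof.
rewrite {}/X {}/Y => p_prim.
have [phi [phi_bij ->]] :
    exists phi : UMagmaMorphism.type F F, bijective phi /\ p = phi x.
  by case: p_prim => phi ?; exists (group_morphism _ _ phi).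
have [psi _ psiK] := phi_bij.
set X' := exponent_sum false (phi x); set Y' := exponent_sum true (phi x).
set Z := exponent_sum false (phi y); set W := exponent_sum true (phi y).
(* As [phi (psi (gen s))] is [gen s], these four equations say that the matrix of the pairs of
   [psi x] and [psi y] times the matrix of [phi] is the identity. *)
have E t s := exponent_sum_morph phi t (psi (gen s)).
have := (E false false, E true false, E false true, E true true).
rewrite !psiK !exponent_sum_gen /= -/X' -/Y' -/Z -/W => -[[[E1 E2] E3] E4].
set a := exponent_sum false (psi (gen false)) in E1 E2.
set b := exponent_sum true (psi (gen false)) in E1 E2.
set c := exponent_sum false (psi (gen true)) in E3 E4.
set d := exponent_sum true (psi (gen true)) in E3 E4.
have det1 : ((a * d - b * c) * (X' * W - Y' * Z) = 1)%R.
  transitivity ((a * X' + b * Z) * (c * Y' + d * W)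
                - (a * Y' + b * W) * (c * X' + d * Z))%R; first by ring.
  by rewrite -E1 -E2 -E3 -E4.
split.
  (* Expanding the second determinant in [det1] along its row [(X', Y')] gives the Bezout
     coefficients. *)
  exists ((a * d - b * c) * W)%R, (- ((a * d - b * c) * Z))%R.
  by rewrite -det1; ring.
move=> r; rewrite -[r]psiK; move: (psi r) => {r}r.
rewrite in_normal_closure_iso // in_normal_closure_x.
rewrite !(exponent_sum_morph _ _ r) -/X' -/Y' -/Z -/W.
set k := exponent_sum false r; set l := exponent_sum true r.
(* The cross product with [(X', Y')] eliminates [k], leaving [l] times a determinant that [det1]
   makes nonzero. *)
have lE : ((k * Y' + l * W) * X' - (k * X' + l * Z) * Y' = l * (X' * W - Y' * Z))%R.
  by ring.
split=> [l0|/esym/eqP]; first by rewrite l0; ring.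
rewrite -subr_eq0 lE mulf_eq0 => /orP[/eqP//|/eqP det0].
by move: det1; rewrite det0 mulr0.
Qed.

Lemma proportional_coprime (A B X Y u v : int) :
    (u * X + v * Y = 1)%R -> (A, B) <> (0%R, 0%R) ->
  (A * Y = B * X)%R <->
  (X, Y) = ((A %/ gcdz A B)%Z, (B %/ gcdz A B)%Z) \/
  (X, Y) = ((- (A %/ gcdz A B)%Z)%R, (- (B %/ gcdz A B)%Z)%R).
Proof.
move=> uv AB0; split=> [ABXY|XYE]; last first.
  by case: XYE => -[-> ->]; rewrite ?mulrN mulz_divCA_gcd.
(* If [(A, B)] is [k] times [(X, Y)], the Bezout relation forces this value of [k]. *)
pose k := (u * A + v * B)%R.
have AE : (A = k * X)%R.
  transitivity (u * A * X + v * (B * X))%R; last by rewrite /k; ring.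
  by rewrite -ABXY -[LHS]mulr1 -uv; ring.
have BE : (B = k * Y)%R.
  transitivity (u * (A * Y) + v * B * Y)%R; last by rewrite /k; ring.
  by rewrite ABXY -[LHS]mulr1 -uv; ring.
have XY1 : gcdz X Y = 1%R.
  by apply/eqP; rewrite -/(coprimez X Y); apply/coprimezP; exists (u, v).
have k0 : k != 0%R by apply/eqP => k0; apply: AB0; rewrite AE BE k0 !mul0r.
have gE : gcdz A B = `|k|%R by rewrite AE BE -mulz_gcdr XY1 mulr1.
rewrite gE AE BE.
(* The gcd is the absolute value of [k], so the sign of [k] selects the alternative. *)
have [kp|kn|k0'] := ltgtP k 0%R; last by rewrite k0' eqxx in k0.
  right; rewrite ltr0_norm // !divzN !mulKz //.
  by rewrite !opprK.
by left; rewrite gtr0_norm // !mulKz.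
Qed.

Theorem theorem6 (r : F) (A B : int) (hr : exponent_sum_pair r = (A, B)) :
  ((A, B) = (0%Z, 0%Z) ->
     forall p : F, primitive p -> in_normal_closure p r) /\
  ((A, B) <> (0%Z, 0%Z) ->
     forall p : F, primitive p ->
       (in_normal_closure p r <->
        exponent_sum_pair p = ((A %/ gcdz A B)%Z, (B %/ gcdz A B)%Z) \/
        exponent_sum_pair p = (- (A %/ gcdz A B)%Z, - (B %/ gcdz A B)%Z)%R)).
Proof.
case: hr => rA rB; split=> AB p /primitive_bezout_normal_closure [[u [v uv]] ->].
  by case: AB => A0 B0; rewrite rA rB A0 B0 !mul0r.
by rewrite rA rB; apply: proportional_coprime uv AB.
Qed.
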